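(* Let $p,s\ge 1$ be integers, let $A,B\in S$, and for $i=1,\ldots,s$ let $A_i\in\mathrm{span}\{A\}$ and $B_i\in\mathrm{span}\{B\}$. The following statements are equivalent: (A) the data yield a splitting scheme of order at least $p$, i.e. $e^{A_1t}e^{B_1t}\cdots e^{A_st}e^{B_st}-e^{(A+B)t}=O(t^{p+1})$; (B) $\log(e^{A_1}e^{B_1}\cdots e^{A_s}e^{B_s})-(A+B)$ has homogeneous terms of degree $j$ equal to zero for $j=1,\ldots,p$.
   Context: $k$ is a field of characteristic zero, $S$ is a set of non-commuting variables, and $k\langle\!\langle S\rangle\!\rangle$ is the algebra of formal power series in the non-commuting variables $S$ with coefficients in $k$, graded by word length: elements of $k$ have degree $0$, words $s_1\cdots s_n$ ($s_i\in S$) have degree $n$, and every element is uniquely a sum of its homogeneous components. $\mathrm{span}\{A\}$ is the $k$-linear span of $A$, so $A_i=a_iA$, $B_i=b_iB$ with $a_i,b_i\in k$. For $g$ without constant term, $e^g:=\sum_{j\ge0}\frac1{j!}g^j$. $\log(e^{A_1}e^{B_1}\cdots e^{A_s}e^{B_s})$ denotes the unique $Z\in k\langle\!\langle S\rangle\!\rangle$ without constant term such that $e^Z=e^{A_1}e^{B_1}\cdots e^{A_s}e^{B_s}$. Expressions such as $e^{A_1t}$ are taken in the ring $k\langle\!\langle S\rangle\!\rangle\langle\!\langle t\rangle\!\rangle$ of formal power series in one variable $t$ (commuting with the coefficients) over $k\langle\!\langle S\rangle\!\rangle$, and $\sum_{j\ge 0} r_jt^j=O(t^{p+1})$ means $r_0=\cdots=r_p=0$.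 *)

(* Defs.v *)
From HB Require Import structures.
From mathcomp Require Import all_boot all_algebra.
From mathcomp Require Import boolp classical_sets.

Set Implicit Arguments.
Unset Strict Implicit.
Unset Printing Implicit Defensive.

Import GRing.Theory.
Local Open Scope ring_scope.

(* R<<S>>: formal power series in the non-commuting variables S, given by the
   coefficient of each word; the variables commute with the coefficients, but R
   itself need not be commutative.  A record rather than a plain function type,
   so that * is never read as the pointwise product of functions. *)
Record fps (R S : Type) := FPS { coefw :> seq S -> R }.

HB.instance Definition _ (R S : Type) := [isNew for @coefw R S].
HB.instance Definition _ (R : eqType) (S : Type) :=
  [Equality of fps R S by <:].
HB.instance Definition _ (R : choiceType) (S : Type) :=
  [Choice of fps R S by <:].

Lemma fpsP (R S : Type) (f g : fps R S) : (forall w, f w = g w) -> f = g.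
Proof. by case: f g => [f] [g] /= /funext ->. Qed.

Section Zmodule.
Variables (R : zmodType) (S : Type).
Implicit Types f g h : fps R S.

Definition fps_zero : fps R S := FPS (fun=> 0).
Definition fps_opp f : fps R S := FPS (fun w => - f w).
Definition fps_add f g : fps R S := FPS (fun w => f w + g w).

Fact fps_addA : associative fps_add.
Proof. by move=> f g h; apply: fpsP => w; apply: addrA. Qed.
Fact fps_addC : commutative fps_add.
Proof. by move=> f g; apply: fpsP => w; apply: addrC. Qed.
Fact fps_add0 : left_id fps_zero fps_add.
Proof. by move=> f; apply: fpsP => w; apply: add0r. Qed.
Fact fps_addN : left_inverse fps_zero fps_opp fps_add.
Proof. by move=> f; apply: fpsP => w; apply: addNr. Qed.

HB.instance Definition _ := GRing.isZmodule.Build (fps R S)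
  fps_addA fps_addC fps_add0 fps_addN.

Lemma fps0E w : (0 : fps R S) w = 0. Proof. by []. Qed.
Lemma fpsDE f g w : (f + g) w = f w + g w. Proof. by []. Qed.
Lemma fpsNE f w : (- f) w = - f w. Proof. by []. Qed.
Lemma fpsBE f g w : (f - g) w = f w - g w. Proof. by []. Qed.

Definition fpsC (c : R) : fps R S := FPS (fun w => if nilp w then c else 0).

Definition fps_homog (j : nat) f : fps R S :=
  FPS (fun w => if size w == j then f w else 0).

End Zmodule.

Section Ring.
Variables (R : nzRingType) (S : Type).
Implicit Types f g h : fps R S.

(* Cauchy product: the sum runs over the factorizations of w into two words. *)
Definition fps_mul f g : fps R S :=
  FPS (fun w => \sum_(i < (size w).+1) f (take i w) * g (drop i w)).

Let shift (x : S) f : fps R S := FPS (fun w => f (x :: w)).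

Let mul_nil f g : fps_mul f g [::] = f [::] * g [::].
Proof. by rewrite /= big_ord1. Qed.

Let mul_cons f g x w :
  fps_mul f g (x :: w) = f [::] * g (x :: w) + fps_mul (shift x f) g w.
Proof. by rewrite /= big_ord_recl. Qed.

Fact fps_mulDl : left_distributive fps_mul +%R.
Proof.
move=> f g h; apply: fpsP => w /=; rewrite -big_split.
by apply: eq_bigr => i _; apply: mulrDl.
Qed.

Fact fps_mulDr : right_distributive fps_mul +%R.
Proof.
move=> f g h; apply: fpsP => w /=; rewrite -big_split.
by apply: eq_bigr => i _; apply: mulrDr.
Qed.

Fact fps_mulA : associative fps_mul.
Proof.
move=> f g h; apply: fpsP => w.
elim: w f => [|x w IHw] f; first by rewrite !mul_nil mulrA.
have shift_mul : shift x (fps_mul f g) =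
    FPS (fun v => f [::] * g (x :: v)) + fps_mul (shift x f) g.
  by apply: fpsP => v; rewrite /shift /= big_ord_recl.
rewrite mul_cons [RHS]mul_cons shift_mul fps_mulDl fpsDE -IHw mul_nil.
rewrite mul_cons mulrDr addrA; congr (_ + _ + _); first exact: mulrA.
by rewrite /= big_distrr; apply: eq_bigr => i _; apply: mulrA.
Qed.

Fact fps_mul1 : left_id (fpsC S (1 : R)) fps_mul.
Proof.
move=> f; apply: fpsP => -[|x w]; first by rewrite mul_nil mul1r.
rewrite mul_cons mul1r /= big1 ?addr0 // => i _; exact: mul0r.
Qed.

Fact fps_mulr1 : right_id (fpsC S (1 : R)) fps_mul.
Proof.
move=> f; apply: fpsP => w; elim: w f => [|x w IHw] f.
  by rewrite mul_nil mulr1.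
by rewrite mul_cons IHw /= mulr0 add0r.
Qed.

Fact fps_one_neq0 : fpsC S (1 : R) != 0.
Proof.
apply/eqP => /(congr1 (fun f : fps R S => f [::])) /= /eqP.
by rewrite oner_eq0.
Qed.

HB.instance Definition _ := GRing.Zmodule_isNzRing.Build (fps R S)
  fps_mulA fps_mul1 fps_mulr1 fps_mulDl fps_mulDr fps_one_neq0.

Lemma fps1E w : (1 : fps R S) w = if nilp w then 1 else 0.
Proof. by []. Qed.

Lemma fpsME f g w :
  (f * g) w = \sum_(i < (size w).+1) f (take i w) * g (drop i w).
Proof. by []. Qed.

Lemma fpsM_nil f g : (f * g) [::] = f [::] * g [::].
Proof. exact: mul_nil. Qed.

Definition fpsX (x : S) : fps R S := FPS (fun w => `[< w = [:: x] >]%:R).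

Lemma fps_exprn_nil f j : (f ^+ j) [::] = f [::] ^+ j.
Proof. by elim: j => [|j IHj]; rewrite ?exprS // fpsM_nil IHj. Qed.

Lemma fps_exprn_small f j w :
  f [::] = 0 -> (size w < j)%N -> (f ^+ j) w = 0.
Proof.
move=> f0; elim: j w => [//|j IHj] w; rewrite ltnS => le_wj.
rewrite exprS fpsME big1 // => -[[|i] /= lt_iw] _; first by rewrite take0 f0 mul0r.
by rewrite IHj ?mulr0 // size_drop; case: (w) lt_iw le_wj => // x v _ /=;
  rewrite subSS; apply: leq_ltn_trans; apply: leq_subr.
Qed.

End Ring.

Section Algebra.
Variables (k : fieldType) (R : algType k) (S : Type).
Implicit Types (a b : k) (f g h : fps R S).

Definition fps_scale a f : fps R S := FPS (fun w => a *: f w).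

Fact fps_scaleA a b f : fps_scale a (fps_scale b f) = fps_scale (a * b) f.
Proof. by apply: fpsP => w; apply: scalerA. Qed.
Fact fps_scale1 : left_id 1 fps_scale.
Proof. by move=> f; apply: fpsP => w; apply: scale1r. Qed.
Fact fps_scaleDr : right_distributive fps_scale +%R.
Proof. by move=> a f g; apply: fpsP => w; apply: scalerDr. Qed.
Fact fps_scaleDl f : {morph fps_scale^~ f : a b / a + b}.
Proof. by move=> a b; apply: fpsP => w; apply: scalerDl. Qed.

HB.instance Definition _ := GRing.Zmodule_isLmodule.Build k (fps R S)
  fps_scaleA fps_scale1 fps_scaleDr fps_scaleDl.

Lemma fpsZE a f w : (a *: f) w = a *: f w. Proof. by []. Qed.

Fact fps_scaleAl a f g : a *: (f * g) = a *: f * g.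
Proof.
apply: fpsP => w; rewrite fpsZE !fpsME scaler_sumr.
by apply: eq_bigr => i _; apply: scalerAl.
Qed.
HB.instance Definition _ :=
  GRing.Lmodule_isLalgebra.Build k (fps R S) fps_scaleAl.

Fact fps_scaleAr a f g : a *: (f * g) = f * (a *: g).
Proof.
apply: fpsP => w; rewrite fpsZE !fpsME scaler_sumr.
by apply: eq_bigr => i _; apply: scalerAr.
Qed.
HB.instance Definition _ :=
  GRing.Lalgebra_isAlgebra.Build k (fps R S) fps_scaleAr.

(* e^g for g without constant term.  The powers g ^+ j with j > size w do not
   contribute to the coefficient of w, so that the sum over all j is finite in
   each coefficient (see fps_expE). *)
Definition fps_exp g : fps R S :=
  FPS (fun w => \sum_(j < (size w).+1) (j`!%:R : k)^-1 *: (g ^+ j) w).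

Lemma fps_expE g w n : g [::] = 0 -> (size w < n)%N ->
  fps_exp g w = \sum_(j < n) (j`!%:R : k)^-1 *: (g ^+ j) w.
Proof.
move=> g0 lt_wn; rewrite /fps_exp /=.
rewrite (big_ord_widen n (fun j => (j`!%:R : k)^-1 *: (g ^+ j) w)) //.
rewrite big_mkcond; apply: eq_bigr => j _; rewrite ltnS; case: leqP => // lt_wj.
by rewrite fps_exprn_small ?scaler0.
Qed.

Definition is_fps_log f : set (fps R S) :=
  [set Z : fps R S | Z [::] = 0 /\ fps_exp Z = f]%classic.

(* the unique Z without constant term such that e^Z = f; existence and
   uniqueness for f with constant term 1 are proved in fps_log_exists_unique *)
Definition fps_log f : fps R S := xget 0 (is_fps_log f).

Let agree n f g := forall w, (size w < n)%N -> f w = g w.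

Let agreeM n f f' g g' : f [::] = 0 -> f' [::] = 0 -> g [::] = 0 ->
  g' [::] = 0 -> agree n f f' -> agree n g g' -> agree n.+1 (f * g) (f' * g').
Proof.
move=> f0 f'0 g0 g'0 ff' gg' w; rewrite ltnS => le_wn; rewrite !fpsME.
apply: eq_bigr => -[i /= lt_iw] _; rewrite ltnS in lt_iw.
case: (posnP i) => [->|i_gt0]; first by rewrite take0 f0 f'0 !mul0r.
case: (ltngtP i (size w)) lt_iw => // [lt_iw _|-> _]; last first.
  by rewrite drop_size g0 g'0 !mulr0.
rewrite ff' ?gg' // ?size_drop ?size_take ?lt_iw.
  by apply: leq_trans le_wn; rewrite ltn_subrL i_gt0 (leq_trans _ lt_iw).
exact: leq_trans le_wn.
Qed.

Let agreeX n f g j : f [::] = 0 -> g [::] = 0 -> agree n f g ->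
  agree n.+1 (f ^+ j.+2) (g ^+ j.+2).
Proof.
move=> f0 g0 fg; have X0 h i : h [::] = 0 -> (h ^+ i.+1) [::] = 0.
  by move=> h0; rewrite fps_exprn_nil h0 expr0n.
elim: j => [|j IHj]; first by rewrite !expr2; apply: agreeM.
rewrite exprS [in X in agree _ _ X]exprS; apply: agreeM; rewrite ?X0 //.
by move=> w lt_wn; apply: IHj; apply: ltnW.
Qed.

Let exp_agree n f g : f [::] = 0 -> g [::] = 0 -> agree n f g ->
  agree n.+1 (fps_exp f - f) (fps_exp g - g).
Proof.
move=> f0 g0 fg w lt_wn; rewrite !fpsBE /fps_exp /=.
case: w lt_wn => [|x w] lt_wn; first by rewrite f0 g0 !big_ord1.
have cancel (a b c : R) : a + (b + c) - b = a + c.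
  by rewrite [b + c]addrC addrA addrK.
rewrite !big_ord_recl /= invr1 !scale1r !expr1 !cancel; congr (_ + _).
apply: eq_bigr => j _; congr (_ *: _).
exact: (@agreeX n f g j f0 g0 fg (x :: w) lt_wn).
Qed.

Lemma fps_log_exists_unique f :
  f [::] = 1 -> exists! Z : fps R S, Z [::] = 0 /\ fps_exp Z = f.
Proof.
move=> f1.
pose Z n := iter n (fun Y => f - (fps_exp Y - Y)) (0 : fps R S).
have Z0 n : Z n [::] = 0.
  elim: n => // n IHn; rewrite /Z iterS -/(Z n) !fpsBE IHn subr0 f1.
  by rewrite /fps_exp /= big_ord1 invr1 scale1r subrr.
have ZS n : agree n (Z n) (Z n.+1).
  elim: n => // n IHn w lt_wn; rewrite /Z 2!iterS fpsBE [RHS]fpsBE.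
  congr (_ - _); exact: exp_agree IHn _ lt_wn.
have Zm m n : (m <= n)%N -> agree m (Z m) (Z n).
  move=> /subnKC <-; elim: (n - m)%N => [|d IHd] w lt_wm; first by rewrite addn0.
  by rewrite addnS IHd // ZS // ltn_addr.
pose L : fps R S := FPS (fun w => Z (size w).+1 w).
have L0 : L [::] = 0 := Z0 1%N.
have LZ n : agree n L (Z n) by move=> w lt_wn; apply: Zm.
have expL : fps_exp L = f.
  apply: fpsP => v; have LE : L v = (f - (fps_exp (Z (size v)) - Z (size v))) v.
    by [].
  have agL := exp_agree L0 (Z0 _) (LZ (size v)) (ltnSn _).
  move: LE; rewrite fpsBE -agL fpsBE opprB addrCA -[LHS]addr0 => /addrI/esym.
  by move/eqP; rewrite subr_eq0 => /eqP.
exists L; split=> // Y [Y0 expY].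
have LY n : agree n L Y.
  elim: n => // n IHn w lt_wn; have := exp_agree L0 Y0 IHn lt_wn.
  by rewrite expL expY !fpsBE => /addrI /oppr_inj.
by apply: fpsP => w; apply: (LY (size w).+1).
Qed.

End Algebra.

(* k<<S>>; the coefficients are taken in k^o, i.e. k as an algebra over itself *)
Notation ncseries k S := (fps (k : fieldType)^o S).

(* R<<t>> is the case of a single variable: t^j is the word nseq j tt. *)
Notation tseries R := (fps R unit).

Definition tvar (R : nzRingType) : tseries R := fpsX R tt.

Definition bigO_t (R : zmodType) (q : nat) (f : tseries R) :=
  forall j : nat, (j < q)%N -> f (nseq j tt) = 0.

(* Main.v *)
Require Import Defs.
From mathcomp Require Import all_boot all_algebra.
From mathcomp Require Import boolp classical_sets.

Set Implicit Arguments.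
Unset Strict Implicit.
Unset Printing Implicit Defensive.

Import GRing.Theory.
Local Open Scope ring_scope.

(** Sending a series [f] to [\sum_j f_j t^j], with [f_j] its homogeneous
    component of degree [j], is an algebra morphism which commutes with [exp]
    and sends [a] to [a t] when [a] is homogeneous of degree 1.  Hence (A) says
    that [P := e^{A_1} e^{B_1} ... e^{A_s} e^{B_s}] and [e^{A+B}] agree in
    degrees at most [p].  As [e^f - e^g] and [f - g] have the same leading term
    when [f] and [g] have no constant term, this holds if and only if [log P]
    and [A + B] agree in degrees at most [p]. *)

Lemma fpsCM (R : nzRingType) (S : Type) (c : R) (f : fps R S) w :
  (fpsC S c * f) w = c * f w.
Proof.
rewrite fpsME big_ord_recl take0 drop0 /= big1 ?addr0 // => -[i lt_iw] _.
by case: w lt_iw => [|x w] //= _; rewrite mul0r.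
Qed.

Section Grading.
Variables (R : nzRingType) (S : Type).
Implicit Types f g : fps R S.

Lemma fps_homogE j f w : fps_homog j f w = if size w == j then f w else 0.
Proof. by []. Qed.

(** On a word of length [n], the summand of index [i] keeps only the cut after [i] letters. On any
    other word, no cut yields lengths [i] and [n - i]. *)
Lemma fps_homogM n f g :
  fps_homog n (f * g) = \sum_(i < n.+1) fps_homog i f * fps_homog (n - i) g.
Proof.
apply: fpsP => w; rewrite fps_homogE.
rewrite (big_morph (fun h : fps R S => h w) (id1 := 0) (op1 := +%R)) //.
case: eqP => [<-|ne_wn].
  rewrite fpsME; apply: eq_bigr => i _; rewrite fpsME (bigD1 i) //= big1.
    have le_iw : (i <= size w)%N by rewrite -ltnS.
    by rewrite size_drop size_takel // !eqxx addr0.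
  move=> l /negbTE ne_li; rewrite size_takel -1?ltnS //.
  by rewrite val_eqE ne_li mul0r.
rewrite big1 // => i _; rewrite fpsME big1 // => l _; rewrite !fps_homogE.
have le_lw : (l <= size w)%N by rewrite -ltnS.
have le_in : (i <= n)%N by rewrite -ltnS.
rewrite size_drop size_takel //; case: eqP => [eq_li|_]; last by rewrite mul0r.
case: eqP => [eq_d|_]; last by rewrite mulr0.
by case: ne_wn; rewrite -(subnKC le_lw) eq_d eq_li subnKC.
Qed.

(** A word over [unit] is determined by its length, so [size v] is the exponent of [t]. *)
Definition fps_grade f : tseries (fps R S) :=
  FPS (fun v => fps_homog (size v) f).

Lemma fps_gradeE f v w :
  fps_grade f v w = if size w == size v then f w else 0.
Proof. by []. Qed.

Lemma fps_grade1 : fps_grade 1 = 1.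
Proof.
apply: fpsP => v; apply: fpsP => w; rewrite fps_gradeE !fps1E.
by case: w v => [|x w] [|y v] //=; case: ifP.
Qed.

Lemma fps_gradeM : {morph fps_grade : f g / f * g}.
Proof.
move=> f g; apply: fpsP => v; rewrite fpsME [LHS]fps_homogM.
apply: eq_bigr => i _; rewrite /= size_drop size_takel //.
by rewrite -ltnS.
Qed.

Lemma fps_gradeB : {morph fps_grade : f g / f - g}.
Proof.
move=> f g; apply: fpsP => v; apply: fpsP => w.
by rewrite !(fpsBE, fps_gradeE); case: ifP => // _; rewrite subr0.
Qed.

Lemma fps_gradeX f n : fps_grade (f ^+ n) = fps_grade f ^+ n.
Proof.
by elim: n => [|n IHn]; rewrite ?fps_grade1 // !exprS fps_gradeM IHn.
Qed.

Lemma fps_grade_prod n (F : 'I_n -> fps R S) :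
  fps_grade (\prod_(i < n) F i) = \prod_(i < n) fps_grade (F i).
Proof. exact: (big_morph _ fps_gradeM fps_grade1). Qed.

Lemma fps_grade_homog1 f :
  fps_homog 1 f = f -> fps_grade f = fpsC unit f * tvar (fps R S).
Proof.
move=> f1; apply: fpsP => v; rewrite fpsCM /= -{1}f1.
(* Over a one-letter alphabet, the word [t] is recognized by its length. *)
have -> : `[< v = [:: tt] >] = (size v == 1%N).
  by apply/asboolP/eqP => [-> //|]; case: v => [|[] []].
apply: fpsP => w; case: eqP => [->|/eqP ne_v1].
  by rewrite mulr1 -{2}f1 !fps_homogE; case: eqP.
rewrite mulr0 !fps_homogE; case: (size w =P size v) => // ->.
by rewrite (negbTE ne_v1).
Qed.

Lemma fps_homog1X (x : S) : fps_homog 1 (fpsX R x) = fpsX R x.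
Proof.
apply: fpsP => w; rewrite fps_homogE; case: eqP => //= ne_w1.
by rewrite asboolF // => eq_w; rewrite eq_w in ne_w1.
Qed.

Lemma fps_homogD j f g : fps_homog j (f + g) = fps_homog j f + fps_homog j g.
Proof.
by apply: fpsP => w; rewrite !(fpsDE, fps_homogE); case: eqP; rewrite ?addr0.
Qed.

Definition fps_ord_ge n f := forall w, (size w < n)%N -> f w = 0.

(** Any cut of a word shorter than [m + n] has a left part shorter than [m] or a right part shorter
    than [n]. *)
Lemma fps_ord_geM m n f g :
  fps_ord_ge m f -> fps_ord_ge n g -> fps_ord_ge (m + n) (f * g).
Proof.
move=> f_m g_n w lt_w; rewrite fpsME big1 // => -[i /= le_iw] _.
case: (ltnP i m) => [lt_im|le_mi].
  by rewrite f_m ?mul0r // size_takel -1?ltnS.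
rewrite g_n ?mulr0 // size_drop ltn_subLR -1?ltnS //.
by apply: leq_trans lt_w _; rewrite leq_add2r.
Qed.

Lemma fps_ord_geD n f g :
  fps_ord_ge n f -> fps_ord_ge n g -> fps_ord_ge n (f + g).
Proof. by move=> f_n g_n w lt_w; rewrite fpsDE f_n ?g_n ?addr0. Qed.

Lemma fps_ord_ge1 f : f [::] = 0 -> fps_ord_ge 1 f.
Proof. by move=> f0 []. Qed.

Lemma fps_ord_geX f n : f [::] = 0 -> fps_ord_ge n (f ^+ n).
Proof. by move=> f0 w; apply: fps_exprn_small. Qed.

Lemma fps_ord_ge_subX n f g j : f [::] = 0 -> g [::] = 0 ->
  fps_ord_ge n (f - g) -> fps_ord_ge (n + j) (f ^+ j.+1 - g ^+ j.+1).
Proof.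
move=> f0 g0 fg; elim: j => [|j IHj]; first by rewrite addn0.
(* This telescoping holds without commutativity. The two summands have order at least [n + (j + 1)]
   and [1 + (n + j)]. *)
have -> : f ^+ j.+2 - g ^+ j.+2
    = (f - g) * f ^+ j.+1 + g * (f ^+ j.+1 - g ^+ j.+1).
  by rewrite mulrBl mulrBr addrA subrK -!exprS.
apply: fps_ord_geD; first by apply: fps_ord_geM => //; apply: fps_ord_geX.
by rewrite addnS -add1n; apply: fps_ord_geM IHj; apply: fps_ord_ge1.
Qed.

Lemma bigO_t_grade n f :
  bigO_t n (fps_grade f) <-> fps_ord_ge n f.
Proof.
split=> [f_n w lt_w|f_n j lt_j].
  have /(congr1 (fun h : fps R S => h w)) := f_n _ lt_w.
  by rewrite fps_gradeE size_nseq eqxx.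
apply: fpsP => w; rewrite fps_gradeE size_nseq fps0E.
by case: eqP => // eq_w; rewrite f_n ?eq_w.
Qed.

(** Degree 0 lies outside the range of [j]; it is covered by [f [::] = 0]. *)
Lemma fps_ord_ge_homog p f : f [::] = 0 ->
  fps_ord_ge p.+1 f <-> forall j, (1 <= j <= p)%N -> fps_homog j f = 0.
Proof.
move=> f0; split=> [f_p j /andP[_ le_jp]|f_p w lt_w].
  by apply: fpsP => w; rewrite fps_homogE; case: eqP => // eq_w;
    rewrite f_p // eq_w ltnS.
case: w lt_w => [//|x w] lt_w.
have /(congr1 (fun h : fps R S => h (x :: w))) := f_p (size (x :: w)) lt_w.
by rewrite fps_homogE eqxx.
Qed.

End Grading.

Section Exponential.
Variables (k : fieldType) (R : algType k) (S : Type).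
Implicit Types f g : fps R S.

Lemma fps_homogZ j (a : k) f : fps_homog j (a *: f) = a *: fps_homog j f.
Proof.
by apply: fpsP => w; rewrite !(fpsZE, fps_homogE); case: eqP; rewrite ?scaler0.
Qed.

Lemma fps_exp_nil g : fps_exp g [::] = 1.
Proof. by rewrite /= big_ord1 invr1 scale1r. Qed.

(** The two exponential sums are truncated at [size w] and at [size v]; these bounds coincide
    wherever the graded coefficient can be nonzero. *)
Lemma fps_grade_exp g : fps_grade (fps_exp g) = fps_exp (fps_grade g).
Proof.
apply: fpsP => v; apply: fpsP => w; rewrite fps_gradeE /=.
rewrite (big_morph (fun h : fps R S => h w) (id1 := 0) (op1 := +%R)) //.
case: eqP => [eq_wv|/eqP/negbTE ne_wv].
  rewrite eq_wv; apply: eq_bigr => j _.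
  by rewrite fpsZE -fps_gradeX fps_gradeE eq_wv eqxx.
by rewrite big1 // => j _; rewrite fpsZE -fps_gradeX fps_gradeE ne_wv scaler0.
Qed.

Lemma fps_prod_expM_nil n (F G : 'I_n -> fps R S) :
  (\prod_(i < n) (fps_exp (F i) * fps_exp (G i))) [::] = 1.
Proof.
rewrite (big_morph (fun h : fps R S => h [::]) (id1 := 1) (op1 := *%R)) //;
  last by move=> f g; rewrite fpsM_nil.
by rewrite big1 // => i _; rewrite fpsM_nil !fps_exp_nil mulr1.
Qed.

Lemma fps_grade_expM_homog1 f g : fps_homog 1 f = f -> fps_homog 1 g = g ->
  fps_grade (fps_exp f * fps_exp g) =
  fps_exp (fpsC unit f * tvar (fps R S)) *
  fps_exp (fpsC unit g * tvar (fps R S)).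
Proof.
by move=> f1 g1; rewrite fps_gradeM !fps_grade_exp !fps_grade_homog1.
Qed.

(** The terms of index 0 and 1 cancel against [f - g]. The others are multiples of differences of
    powers with exponent at least 2, which gain at least one degree over [f - g]. *)
Lemma fps_exp_sub_ord_ge n f g : f [::] = 0 -> g [::] = 0 ->
  fps_ord_ge n (f - g) ->
  fps_ord_ge n.+1 ((fps_exp f - fps_exp g) - (f - g)).
Proof.
move=> f0 g0 fg w lt_w; rewrite !fpsBE /=; case: w lt_w => [|x w] lt_w.
  by rewrite !big_ord1 !expr0 f0 g0 !subrr.
(* On a nonempty word the truncated sum does contain both indices 0 and 1. *)
rewrite -sumrB !big_ord_recl !lift0 !expr0 !expr1 invr1 !scale1r subrr add0r.
rewrite addrAC subrr add0r big1 // => j _; rewrite !lift0.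
rewrite -scalerBr -fpsBE (fps_ord_ge_subX (j := j.+1) f0 g0 fg) ?scaler0 //.
by rewrite addnS (leq_trans lt_w) // ltnS leq_addr.
Qed.

Lemma fps_exp_ord_ge n f g : f [::] = 0 -> g [::] = 0 ->
  fps_ord_ge n (fps_exp f - fps_exp g) <-> fps_ord_ge n (f - g).
Proof.
move=> f0 g0; split=> [|fg w lt_w].
  (* The order of [f - g] climbs one degree at a time: once it is at least [n], the degree [n] parts
     of [f - g] and of the difference of exponentials coincide, and the latter vanishes. *)
  elim: n => // n IHn e_fg w lt_w.
  have /(fps_exp_sub_ord_ge f0 g0) : fps_ord_ge n (f - g).
    by apply: IHn => v /ltnW; apply: e_fg.
  by move=> /(_ w lt_w); rewrite fpsBE e_fg // sub0r => /eqP;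
    rewrite oppr_eq0 => /eqP.
have := fps_exp_sub_ord_ge f0 g0 fg (ltnW lt_w).
by rewrite fpsBE fg // subr0.
Qed.

Lemma fps_logP f : f [::] = 1 -> fps_log f [::] = 0 /\ fps_exp (fps_log f) = f.
Proof.
move=> /fps_log_exists_unique[Z [ZP _]].
exact: (xgetPex 0 (ex_intro (is_fps_log f) Z ZP)).
Qed.

End Exponential.

Unset Implicit Arguments.

Theorem proposition5p2 (k : fieldType) (char0 : [pchar k] =i pred0) (S : Type)
    (p s : nat) (p_ge1 : (1 <= p)%N) (s_ge1 : (1 <= s)%N) (A B : S)
    (As Bs : 'I_s -> ncseries k S)
    (spanA : forall i, exists a : k, As i = a *: fpsX k^o A)
    (spanB : forall i, exists b : k, Bs i = b *: fpsX k^o B) :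
  let AB : ncseries k S := fpsX k^o A + fpsX k^o B in
  let t : tseries (ncseries k S) := tvar (ncseries k S) in
  bigO_t p.+1 (\prod_(i < s) (fps_exp (fpsC unit (As i) * t) *
                              fps_exp (fpsC unit (Bs i) * t))
               - fps_exp (fpsC unit AB * t))
  <->
  (forall j : nat, (1 <= j <= p)%N ->
     fps_homog j (fps_log (\prod_(i < s) (fps_exp (As i) * fps_exp (Bs i))) - AB)
     = 0).
Proof.
move=> AB t.
set P := \prod_(i < s) (fps_exp (As i) * fps_exp (Bs i)).
have homogAB : fps_homog 1 AB = AB by rewrite fps_homogD !fps_homog1X.
have homogA i : fps_homog 1 (As i) = As i.
  by have [a ->] := spanA i; rewrite fps_homogZ fps_homog1X.
have homogB i : fps_homog 1 (Bs i) = Bs i.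
  by have [b ->] := spanB i; rewrite fps_homogZ fps_homog1X.
have P1 : P [::] = 1 by apply: fps_prod_expM_nil.
have AB0 : AB [::] = 0 by rewrite -homogAB.
have [Z0 expZ] := fps_logP P1.
(* All exponents are homogeneous of degree 1, so the whole difference in (A) is the grading of one
   series over [S]. *)
have -> : \prod_(i < s) (fps_exp (fpsC unit (As i) * t) *
                         fps_exp (fpsC unit (Bs i) * t))
    - fps_exp (fpsC unit AB * t) = fps_grade (P - fps_exp AB).
  rewrite fps_gradeB fps_grade_prod fps_grade_exp fps_grade_homog1 //.
  congr (_ - _); apply: eq_bigr => i _.
  by rewrite fps_grade_expM_homog1.
(* Only the exposed [P] becomes an exponential, not the one inside [fps_log P]; the orders of the
   exponents can then be compared. *)
apply: (iff_trans (bigO_t_grade _ _)); rewrite -{1}expZ.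
apply: (iff_trans (fps_exp_ord_ge _ Z0 AB0)).
by apply: fps_ord_ge_homog; rewrite fpsBE Z0 AB0 subrr.
Qed.
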